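(* Let $n,d\ge 1$, let $X_1,\dots,X_n\in\mathbb{R}^d$ and let $\Sigma_1,\dots,\Sigma_n$ be $d\times d$ symmetric positive-definite matrices. Consider the problem of maximizing $\ell_n(G)=\frac1n\sum_{i=1}^n\log f_{G,\Sigma_i}(X_i)$ over $G\in\mathcal{P}(\mathbb{R}^d)$. Then: 1. The maximum is attained: there exists a maximizer $\widehat G_n$ that is discrete with at most $n$ atoms. The vector $\hat L=(\hat L_1,\dots,\hat L_n)=(f_{\widehat G_n,\Sigma_i}(X_i))_{i=1}^n$ is unique, i.e. it is the same for every maximizer $\widehat G_n$. 2. A measure $\widehat G_n\in\mathcal{P}(\mathbb{R}^d)$ is a maximizer if and only if $D(\widehat G_n,\vartheta)\le 0$ for all $\vartheta\in\mathbb{R}^d$, where $$D(G,\vartheta):=\frac1n\sum_{i=1}^n\frac{\varphi_{\Sigma_i}(X_i-\vartheta)}{f_{G,\Sigma_i}(X_i)}-1 .$$ 3. The support of any maximizer $\widehat G_n$ is contained in the zero set $\mathcal{Z}:=\{\vartheta\in\mathbb{R}^d: D(\widehat G_n,\vartheta)=0\}$, and $\mathcal{Z}$ is equal to the set of global maximizers over $\vartheta\in\mathbb{R}^d$ of the $n$-component mixture density $$\widehat\psi_n(\vartheta):=\sum_{i=1}^n\left(\frac{\hat L_i^{-1}}{\sum_{\iota=1}^n\hat L_\iota^{-1}}\right)\varphi_{\Sigma_i}(X_i-\vartheta).$$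
   Context: $\mathcal{P}(\mathbb{R}^d)$ is the set of all Borel probability measures on $\mathbb{R}^d$. For a symmetric positive-definite $d\times d$ matrix $\Sigma$, $\varphi_\Sigma(x)=\det(2\pi\Sigma)^{-1/2}\exp(-\frac12x^{\mathsf T}\Sigma^{-1}x)$ is the $\mathcal{N}(0,\Sigma)$ density, and for $G\in\mathcal{P}(\mathbb{R}^d)$, $f_{G,\Sigma}(x):=\int\varphi_\Sigma(x-\theta)\,dG(\theta)$. A maximizer of $\ell_n$ over $\mathcal{P}(\mathbb{R}^d)$ is called a nonparametric maximum likelihood estimator (NPMLE). *)

(* Defs.v *)
From HB Require Import structures.
From mathcomp Require Import all_boot all_order all_algebra.
From mathcomp Require Import all_classical all_reals all_analysis.

Set Implicit Arguments.
Unset Strict Implicit.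
Unset Printing Implicit Defensive.

Import Order.TTheory GRing.Theory Num.Theory.
Import numFieldTopology.Exports numFieldNormedType.Exports.

Local Open Scope classical_set_scope.
Local Open Scope ring_scope.

(* R^d as column vectors, with the sigma-algebra generated by the open sets
   of the product topology. The carrier is convertible to ['cV[R]_d], but only
   the latter carries the topological and algebraic structures. *)
Notation borelV R d := (g_sigma_algebraType (@open 'cV[R]_d)).

Definition posdefmx (R : realType) (d : nat) (Sigma : 'M[R]_d) : Prop :=
  Sigma^T = Sigma /\ forall x : 'cV[R]_d, x != 0 -> 0 < (x^T *m Sigma *m x) 0 0.

Definition gauss_density (R : realType) (d : nat) (Sigma : 'M[R]_d)
    (x : 'cV[R]_d) : R :=
  (\det ((2 * pi) *: Sigma)) `^ (- 2^-1)
    * expR (- 2^-1 * (x^T *m invmx Sigma *m x) 0 0).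

(* The integrand is bounded and continuous, hence the real-valued integral
   carries no junk value when [Sigma] is positive definite; moreover it is
   positive, so that [ln] and the inverses below are the usual ones. *)
Definition mixture_density (R : realType) (d : nat)
    (G : probability (borelV R d) R) (Sigma : 'M[R]_d) (x : 'cV[R]_d) : R :=
  \int[G]_t gauss_density Sigma (x - (t : 'cV[R]_d)).

Section npmle.
Context (R : realType) (n d : nat).
Variables (X : 'I_n -> 'cV[R]_d) (Sigma : 'I_n -> 'M[R]_d).
Implicit Type G : probability (borelV R d) R.

Definition loglik G : R :=
  n%:R^-1 * \sum_(i < n) ln (mixture_density G (Sigma i) (X i)).

Definition is_npmle G : Prop :=
  forall G' : probability (borelV R d) R, loglik G' <= loglik G.

Definition fitted_lik G : 'rV[R]_n :=
  \row_(i < n) mixture_density G (Sigma i) (X i).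

Definition dir_deriv G (t : 'cV[R]_d) : R :=
  n%:R^-1 * (\sum_(i < n)
    gauss_density (Sigma i) (X i - t) / mixture_density G (Sigma i) (X i)) - 1.

Definition zero_set G : set 'cV[R]_d := [set t | dir_deriv G t = 0].

Definition dual_mixture (L : 'rV[R]_n) (t : 'cV[R]_d) : R :=
  \sum_(i < n) ((L 0 i)^-1 / \sum_(k < n) (L 0 k)^-1)
    * gauss_density (Sigma i) (X i - t).

End npmle.

Definition discrete_atmost (R : realType) (d : nat) (m : nat)
    (G : probability (borelV R d) R) : Prop :=
  exists (k : nat) (a : 'I_k -> 'cV[R]_d) (w : 'I_k -> R),
    [/\ (k <= m)%N, injective a, (forall j, 0 < w j) &
        forall A : set (borelV R d), measurable A ->
          G A = (\sum_(j < k) (w j)%:E * \d_(a j : borelV R d) A)%E].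

Definition msupport (R : realType) (d : nat)
    (G : probability (borelV R d) R) : set 'cV[R]_d :=
  [set t | forall U : set 'cV[R]_d, open U -> U t -> (0 < G U)%E].

Definition global_maximizers (T : Type) (R : realType) (f : T -> R) : set T :=
  [set t | forall u, f u <= f t].

(* Main.v *)
(* Maximise the product of the fitted likelihoods over mixtures of [n] atoms
   located in a large compact set. A mixture with [n.+1] atoms is dominated
   coordinatewise by one with [n] atoms, so this maximum satisfies the
   first-order condition [D <= 0] on the compact set; outside of it the Gaussian
   densities are below the fitted likelihoods and [D <= 0] is clear. Thus some
   discrete [G0] satisfies [D(G0, .) <= 0] everywhere.
   Integrating [D(G0, .)] against any [G] bounds the sum of the ratios
   [r_i = f_G / f_G0] by [n], and [ln r <= r - 1], with equality only at [r = 1],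
   shows that [G0] is a maximiser and that every maximiser has the same fitted
   likelihoods, hence the same function [D]. Finally [D(G, .) <= 0] has zero
   integral against a maximiser [G], so [G] gives no mass to the open set
   [D < 0]. *)
Require Import Defs.
From HB Require Import structures.
From mathcomp Require Import all_boot all_order all_algebra.
From mathcomp Require Import all_classical all_reals all_analysis.
From mathcomp Require Import measurable_realfun ring lra.
Import Order.TTheory GRing.Theory Num.Theory.
Import numFieldTopology.Exports numFieldNormedType.Exports.
Local Open Scope classical_set_scope.
Local Open Scope ring_scope.
Set Implicit Arguments.
Unset Strict Implicit.
Unset Printing Implicit Defensive.

(** * First-order inequality for products, and reduction of the number of atoms *)

(** The sum is the right derivative at [e = 0] of the logarithm of the product. Instead of
    differentiating, the proof bounds the second-order error explicitly and then picks one small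
    [e]. *)
Lemma prod_first_order (R : realType) (n : nat) (x : 'I_n -> R) :
  (forall i, -1 <= x i) ->
  (forall e, 0 < e -> e <= 2^-1 -> \prod_(i < n) (1 + e * x i) <= 1) ->
  \sum_(i < n) x i <= 0.
Proof.
move=> x_ge xprod; set S := \sum_(i < n) x i.
have lin e : 0 < e -> e <= 2^-1 -> S <= e * (2 * \sum_(i < n) x i ^+ 2).
  move=> e0 e2.
  have pos i : 2^-1 <= 1 + e * x i by have := x_ge i; nra.
  have pos' i : 0 < 1 + e * x i by have := pos i; lra.
  (* With [y = e * x i], this is [1 + z <= expR z] at [z = - y / (1 + y)], inverted. *)
  have expb i : expR (e * x i / (1 + e * x i)) <= 1 + e * x i.
    rewrite -[leLHS]invrK -expRN -lef_pV2 ?posrE ?invr_gt0 ?expR_gt0// ?invrK//.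
    apply: le_trans (expR_ge1Dx _).
    by rewrite le_eqVlt; apply/predU1P; left; field; rewrite gt_eqF.
  have : \prod_(i < n) expR (e * x i / (1 + e * x i)) <= 1.
    apply: le_trans (xprod e e0 e2).
    by apply: ler_prod => i _; rewrite expR_ge0 expb.
  rewrite -expR_sum expR_le1 => sum_le0.
  (* Since [1 + y >= 1/2], [y / (1 + y) = y - y^2 / (1 + y) >= y - 2 y^2]. *)
  have : \sum_(i < n) (e * x i - 2 * e ^+ 2 * x i ^+ 2) <= 0.
    apply: le_trans sum_le0; apply: ler_sum => i _.
    rewrite ler_pdivlMr//; have := pos i; move: (x i) => y yp.
    have : 0 <= (e * y) ^+ 2 * (2 * (1 + e * y) - 1).
      by rewrite mulr_ge0 ?sqr_ge0//; lra.
    by nra.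
  rewrite big_split/= -mulr_sumr sumrN -mulr_sumr -/S subr_le0 => h.
  by rewrite -(ler_pM2l e0); apply: (le_trans h); rewrite le_eqVlt; apply/predU1P; left; ring.
set Q := 2 * _ in lin; have Q0 : 0 <= Q.
  by rewrite mulr_ge0// sumr_ge0// => i _; rewrite sqr_ge0.
clearbody Q; rewrite leNgt; apply/negP => S0.
(* The value [e = 1/2] gives [S <= Q / 2], so [Q > 0] and [e = S / (2 * Q)] is admissible; that
   value yields [S <= S / 2]. *)
have S2 := lin 2^-1 ltac:(lra) ltac:(lra).
have Qp : 0 < Q by nra.
have := lin (S / (2 * Q)).
rewrite divr_gt0 ?mulr_gt0// => /(_ isT).
rewrite ler_pdivrMr ?mulr_gt0// => h.
have /h : S <= 2^-1 * (2 * Q) by nra.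
have -> : S / (2 * Q) * Q = S / 2 by field; rewrite gt_eqF.
by lra.
Qed.

Definition in_simplex (R : realType) (m : nat) (w : 'I_m -> R) : Prop :=
  (forall j, 0 <= w j) /\ \sum_(j < m) w j = 1.

(* Move along a linear dependency of the rows whose weights have nonpositive
   sum until a coordinate vanishes, then renormalise the total mass. *)
Lemma simplex_drop_atom (R : realType) (n : nat) (A : 'I_n.+1 -> 'I_n -> R)
    (u : 'I_n.+1 -> R) :
  (0 < n)%N -> (forall j i, 0 < A j i) -> in_simplex u ->
  exists (j0 : 'I_n.+1) (v : 'I_n -> R), in_simplex v /\
    forall i, \sum_j u j * A j i <= \sum_j v j * A (lift j0 j) i.
Proof.
move=> n0 A0 [u0 u1].
pose M := \matrix_(j, i) A j i.
(* The [n.+1] rows of [M] have rank at most [n]; replacing [c] by [- c] arranges the sign of the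
   sum. *)
have [c [c_neq0 cM c_sum]] : exists c : 'rV[R]_n.+1,
    [/\ c != 0, c *m M = 0 & \sum_j c 0 j <= 0].
  have /rowV0Pn[c /sub_kermxP cM c_neq0] : kermx M != 0.
    rewrite -mxrank_eq0 mxrank_ker -lt0n subn_gt0.
    by rewrite ltnS rank_leq_col.
  have [c_sum|c_sum] := leP (\sum_j c 0 j) 0; first by exists c.
  exists (- c); rewrite oppr_eq0 mulNmx cM oppr0; split=> //.
  under eq_bigr do rewrite mxE.
  by rewrite sumrN oppr_le0 ltW.
have cA i : \sum_j c 0 j * A j i = 0.
  have := congr1 (fun B : 'rV_n => B 0 i) cM; rewrite !mxE => h.
  by rewrite -[RHS]h; apply: eq_bigr => j _; rewrite mxE.
(* Without a negative coordinate, [cA] would be a vanishing sum of nonnegative terms with positive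
   factors [A j i], forcing [c = 0]. *)
have [j1 cj1] : exists j, c 0 j < 0.
  apply: contrapT => /forallNP cpos.
  have c0 j : 0 <= c 0 j by rewrite leNgt; apply/negP/cpos.
  move/negP: c_neq0; apply; apply/eqP/rowP => j; rewrite mxE.
  have := cA (Ordinal n0) => /eqP.
  rewrite psumr_eq0; last by move=> k _; rewrite mulr_ge0// ltW.
  move=> /allP/(_ j (mem_index_enum _)).
  by rewrite mulf_eq0 (gt_eqF (A0 _ _)) orbF => /eqP.
(* Ratio test: the smallest ratio is the longest step that keeps all weights nonnegative, and it
   cancels the weight of [j0]. *)
have [j0 cj0 jmin] : exists2 j0, c 0 j0 < 0 &
    forall j, c 0 j < 0 -> u j0 / - c 0 j0 <= u j / - c 0 j.
  have [j0 cj0 jmin] := @arg_minP _ _ _ j1 (fun j => c 0 j < 0)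
    (fun j => u j / - c 0 j) cj1.
  by exists j0.
pose t := u j0 / - c 0 j0.
have t0 : 0 <= t by rewrite divr_ge0// oppr_ge0 ltW.
pose v j := u j + t * c 0 j.
have v0 j : 0 <= v j.
  have [cj|cj] := ltP (c 0 j) 0; last by rewrite addr_ge0// mulr_ge0.
  have := jmin j cj; rewrite -/t ler_pdivlMr ?oppr_gt0// mulrN /v; lra.
have vj0 : v j0 = 0.
  by rewrite /v /t; field; rewrite lt_eqF.
have vA i : \sum_j v j * A j i = \sum_j u j * A j i.
  under eq_bigr do rewrite mulrDl -mulrA.
  by rewrite big_split/= -mulr_sumr cA mulr0 addr0.
pose S := \sum_j v j.
(* The nonpositive sum of [c] is used here: as [S <= 1], renormalising can only increase the
   mixtures. *)
have S1 : S <= 1.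
  by rewrite /S big_split/= u1 -mulr_sumr gerDl mulr_ge0_le0.
have uA i : 0 < \sum_j u j * A j i.
  have : 0 <= \sum_j u j * A j i.
    by rewrite sumr_ge0// => j _; rewrite mulr_ge0// ltW.
  rewrite le_eqVlt => /orP[|//]; rewrite eq_sym psumr_eq0; last first.
    by move=> j _; rewrite mulr_ge0// ltW.
  move=> /allP uz; move: u1; rewrite big1.
    by move/eqP; rewrite eq_sym oner_eq0.
  move=> j _; have := uz j (mem_index_enum _).
  by rewrite mulf_eq0 (gt_eqF (A0 _ _)) orbF => /eqP.
have S0 : 0 < S.
  have : 0 <= S by rewrite sumr_ge0.
  rewrite le_eqVlt => /orP[|//]; rewrite eq_sym psumr_eq0// => /allP vz.
  have := uA (Ordinal n0); rewrite -vA big1 ?ltxx// => j _.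
  by rewrite (eqP (vz j (mem_index_enum _))) mul0r.
have sum_lift (F : 'I_n.+1 -> R) : F j0 = 0 ->
    \sum_j F j = \sum_j F (lift j0 j).
  by move=> F0; rewrite (bigD1_ord j0)//= F0 add0r.
exists j0, (fun j => v (lift j0 j) / S); split.
  split=> [j|]; first by rewrite divr_ge0// ltW.
  by rewrite -mulr_suml -sum_lift// divff// gt_eqF.
move=> i; rewrite -vA sum_lift ?vj0 ?mul0r//; apply: ler_sum => j _.
rewrite ler_pM2r// ler_pdivlMr//.
by rewrite ler_piMr.
Qed.

(** * Optimal finite mixtures of an abstract family of positive continuous functions *)

Definition mixture_lik (R : realType) (T : Type) (n m : nat)
    (phi : 'I_n -> T -> R) (w : 'I_m -> R) (a : 'I_m -> T) (i : 'I_n) : R :=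
  \sum_(j < m) w j * phi i (a j).

Section finite_mixtures.
Context (R : realType) (T : topologicalType) (n : nat) (phi : 'I_n -> T -> R).
Hypotheses (n_gt0 : (0 < n)%N) (phi_gt0 : forall i t, 0 < phi i t)
  (phi_cont : forall i, continuous (phi i)).

Local Notation lik := (mixture_lik phi).

Lemma lik_gt0 m (w : 'I_m -> R) a i : in_simplex w -> 0 < lik w a i.
Proof.
move=> [w0 w1]; have pos j : 0 <= w j * phi i (a j) by rewrite mulr_ge0// ltW.
have : 0 <= lik w a i by exact: sumr_ge0.
rewrite le_eqVlt => /orP[|//]; rewrite eq_sym psumr_eq0// => /allP wz.
move: w1; rewrite big1; first by move/eqP; rewrite eq_sym oner_eq0.
move=> j _; have := wz j (mem_index_enum _).
by rewrite mulf_eq0 (gt_eqF (phi_gt0 _ _)) orbF => /eqP.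
Qed.

Lemma lik_max_compact (K : set T) : compact K -> K !=set0 ->
  exists (w : 'I_n -> R) (a : 'I_n -> T),
    [/\ in_simplex w, forall j, K (a j) &
     forall (w' : 'I_n -> R) a', in_simplex w' -> (forall j, K (a' j)) ->
       \prod_i lik w' a' i <= \prod_i lik w a i].
Proof.
move=> cK [t0 Kt0].
(* Each coordinate carries a weight together with its atom, so Tychonoff's theorem makes [box]
   compact; the unit-sum constraint is closed. *)
pose P := prod_topology (fun _ : 'I_n => (R * T)%type).
pose box : set P := [set p | forall j, (`[0, 1] `*` K) (p j)].
pose feas : set P := box `&` [set p : P | \sum_j (p j).1 = 1].
pose f (p : P) := \prod_i \sum_j (p j).1 * phi i (p j).2.
have proj j : continuous (fun p : P => p j) by exact: proj_continuous.
have fst_cont : continuous (@fst R T) by case=> x t; exact: cvg_fst.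
have snd_cont : continuous (@snd R T) by case=> x t; exact: cvg_snd.
have proj1 j : continuous (fun p : P => (p j).1).
  move=> p; have := continuous_comp (@proj j p) (fst_cont (p j)).
  exact.
have proj2 j : continuous (fun p : P => (p j).2).
  move=> p; have := continuous_comp (@proj j p) (snd_cont (p j)).
  exact.
have feas_compact : compact feas.
  apply: compact_closedI.
    apply: (@tychonoff 'I_n (fun=> (R * T)%type) (fun=> `[0, 1] `*` K)) => j.
    by apply: compact_setX => //; exact: segment_compact.
  have sum_cont : continuous (fun p : P => \sum_j (p j).1).
    by apply: continuous_big => //; exact: add_continuous.
  by apply: (preimage_closed _ (@closed_eq R 1)) => p _; exact: sum_cont.
have f_cont : continuous f.
  apply: continuous_big; first exact: mul_continuous.
  move=> i _; apply: continuous_big; first exact: add_continuous.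
  move=> j _ p; apply: (cvgM (proj1 j p)).
  exact: (continuous_comp (proj2 j p) (@phi_cont i (p j).2)).
have simplex_le1 (w : 'I_n -> R) : in_simplex w ->
    forall j, `[0, 1]%classic (w j).
  move=> [w0 <-] j; rewrite /= in_itv/= w0/=.
  by rewrite (bigD1 j)//= lerDl sumr_ge0.
have feasE (w : 'I_n -> R) (a : 'I_n -> T) : in_simplex w ->
    (forall j, K (a j)) -> feas (fun j => (w j, a j)).
  by move=> w1 Ka; split; [move=> j; split => //=; exact: simplex_le1|exact: w1.2].
have [|p /[!inE] pfeas pmax] := compact_EVT_max _ feas_compact
    (continuous_subspaceT f_cont).
  exists (fun j => ((j == Ordinal n_gt0)%:R, t0)); apply: feasE => //.
  split=> [j|]; first by rewrite ler0n.
  by rewrite (bigD1 (Ordinal n_gt0))//= big1 ?addr0// => j /negbTE ->.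
case: pfeas => pbox psum.
exists (fun j => (p j).1), (fun j => (p j).2); split.
- by split=> // j; have [] := pbox j; rewrite /= in_itv/= => /andP[].
- by move=> j; have [] := pbox j.
- move=> w' a' w1 Ka; have := pmax (fun j => (w' j, a' j)).
  by rewrite inE; apply; exact: feasE.
Qed.

(* An [n.+1]-atom mixture is dominated coordinatewise by an [n]-atom one, so the
   maximum over [n] atoms also controls the segments towards a new atom [t]. *)
Lemma lik_max_first_order (K : set T) (w : 'I_n -> R) (a : 'I_n -> T) :
  in_simplex w -> (forall j, K (a j)) ->
  (forall (w' : 'I_n -> R) a', in_simplex w' -> (forall j, K (a' j)) ->
       \prod_i lik w' a' i <= \prod_i lik w a i) ->
  forall t, K t -> \sum_i phi i t / lik w a i <= n%:R.
Proof.
move=> w1 Ka wmax t Kt.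
have L0 i : 0 < lik w a i by exact: lik_gt0.
suff : \sum_i (phi i t / lik w a i - 1) <= 0.
  by rewrite big_split/= sumrN sumr_const card_ord subr_le0.
apply: prod_first_order => [i|e e0 e2].
  by rewrite lerBrDl subrr divr_ge0// ltW.
(* The mixture [(1 - e) w + e delta_t], with the new atom [t] at the last index. *)
pose u (j : 'I_n.+1) := if unlift ord_max j is Some k then (1 - e) * w k else e.
pose b (j : 'I_n.+1) := if unlift ord_max j is Some k then a k else t.
have sumE (F : R -> T -> R) : \sum_j F (u j) (b j) =
    F e t + \sum_j F ((1 - e) * w j) (a j).
  rewrite (bigD1_ord ord_max)//= /u /b unlift_none; congr (_ + _).
  by apply: eq_bigr => j _; rewrite liftK.
have u1 : in_simplex u.
  split=> [j|]; last by rewrite (sumE (fun x _ => x)) -mulr_sumr w1.2; ring.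
  rewrite /u; case: unliftP => [k _|_]; last exact: ltW.
  by rewrite mulr_ge0 ?w1.1//; lra.
have [j0 [v [v1 uv]]] :=
  simplex_drop_atom n_gt0 (fun j i => phi_gt0 i (b j)) u1.
have vK j : K (b (lift j0 j)).
  by rewrite /b; case: unliftP.
have vle := wmax v (fun j => b (lift j0 j)) v1 vK.
have -> : \prod_i (1 + e * (phi i t / lik w a i - 1)) =
    (\prod_i \sum_j u j * phi i (b j)) / \prod_i lik w a i.
  rewrite -prodf_div; apply: eq_bigr => i _.
  rewrite (sumE (fun x y => x * phi i y)).
  have -> : \sum_j (1 - e) * w j * phi i (a j) = (1 - e) * lik w a i.
    by rewrite mulr_sumr; apply: eq_bigr => j _; rewrite mulrA.
  by field; rewrite gt_eqF.
rewrite ler_pdivrMr ?mul1r ?prodr_gt0//; apply: le_trans vle.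
apply: ler_prod => i _; rewrite uv andbT sumr_ge0// => j _.
by rewrite mulr_ge0 ?u1.1// ltW.
Qed.

(** On [K] the bound is the first-order condition; off [K] each of the [n] ratios is at most 1,
    provided [K] is chosen from a lower bound on the optimal likelihoods that is known before
    [K]. *)
Lemma lik_optimum (t0 : T) (B : R) : (forall i t, phi i t <= B) ->
  (forall c, 0 < c ->
     exists2 K, compact K & forall t, ~ K t -> forall i, phi i t <= c) ->
  exists (w : 'I_n -> R) (a : 'I_n -> T), in_simplex w /\
    forall t, \sum_i phi i t / lik w a i <= n%:R.
Proof.
move=> phiB vanish.
have B0 : 0 < B := lt_le_trans (phi_gt0 (Ordinal n_gt0) t0) (phiB _ _).
have likB m (w : 'I_m -> R) a i : in_simplex w -> lik w a i <= B.
  move=> [w0 w1]; rewrite -[leRHS]mul1r -w1 mulr_suml; apply: ler_sum => j _.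
  by rewrite ler_wpM2l.
(* The other [n.-1] factors are at most [B], so a lower bound on the product bounds each factor from
   below. *)
have prod_le (F : 'I_n -> R) i : (forall k, 0 < F k) -> (forall k, F k <= B) ->
    \prod_k F k / B ^+ n.-1 <= F i.
  move=> F0 FB; rewrite ler_pdivrMr ?exprn_gt0// (bigD1 i)//=.
  rewrite ler_pM2l//.
  have -> : B ^+ n.-1 = \prod_(k < n | k != i) B.
    by rewrite prodr_const cardC1 card_ord.
  by apply: ler_prod => k _; rewrite FB ltW.
pose c := \prod_i phi i t0 / B ^+ n.-1.
have c0 : 0 < c by rewrite divr_gt0 ?prodr_gt0 ?exprn_gt0.
have [K cK Kc] := vanish (c / 2) ltac:(lra).
(* At [t0] the density is at least [c > c / 2]. Hence the point mass at [t0] is a competitor, and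
   the optimal likelihoods are also at least [c]. *)
have Kt0 : K t0.
  apply: contrapT => /Kc/(_ (Ordinal n_gt0)) h.
  have : c <= phi (Ordinal n_gt0) t0.
    by apply: (prod_le (fun i => phi i t0)) => k.
  by lra.
have [w [a [w1 Ka wmax]]] := lik_max_compact cK (ex_intro _ t0 Kt0).
exists w, a; split=> // t.
have [Kt|Kt] := pselect (K t); first exact: (lik_max_first_order w1 Ka wmax).
have -> : n%:R = \sum_(i < n) (1 : R) by rewrite sumr_const card_ord.
apply: ler_sum => i _; have L0 k : 0 < lik w a k by exact: lik_gt0.
rewrite ler_pdivrMr// mul1r; apply: (@le_trans _ _ c).
  by apply: le_trans (Kc _ Kt i) _; lra.
apply: le_trans (prod_le (lik w a) i L0 (fun k => likB _ _ _ _ w1)).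
rewrite ler_pM2r ?invr_gt0 ?exprn_gt0//.
have := wmax w (fun=> t0) w1 (fun=> Kt0); apply: le_trans.
rewrite le_eqVlt; apply/predU1P; left; apply: eq_bigr => k _.
by rewrite /mixture_lik -mulr_suml w1.2 mul1r.
Qed.

End finite_mixtures.

(** The compactness argument may return repeated atoms and zero weights, which [discrete_atmost]
    forbids. Quantifying over [g] lets all likelihoods be transferred at once. *)
Lemma simplex_merge_atoms (R : realType) (T : choiceType) (n : nat)
    (w : 'I_n -> R) (a : 'I_n -> T) : in_simplex w ->
  exists (k : nat) (b : 'I_k -> T) (v : 'I_k -> R),
    [/\ (k <= n)%N, injective b, (forall j, 0 < v j), \sum_j v j = 1 &
     forall g : T -> R, \sum_j w j * g (a j) = \sum_j v j * g (b j)].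
Proof.
move=> [w0 w1].
pose s := undup [seq a j | j <- enum 'I_n & 0 < w j].
pose b := tnth (in_tuple s).
pose v i := \sum_(j < n | (0 < w j) && (a j == b i)) w j.
have as_ j : 0 < w j -> a j \in s.
  by move=> wj; rewrite mem_undup map_f// mem_filter wj mem_enum.
have sumE (g : T -> R) : \sum_j w j * g (a j) = \sum_j v j * g (b j).
  rewrite (bigID (fun j => 0 < w j))/= addrC big1 ?add0r; last first.
    move=> j; rewrite -leNgt => wj.
    by rewrite (@le_anti _ _ (w j) 0) ?mul0r// wj w0.
  case: n a w w0 w1 @s @b @v as_ => [|m] a w w0 w1 s b v as_.
    by rewrite big_ord0 big1// => i _; rewrite /v big_ord0 mul0r.
  have idx j : 0 < w j -> (index (a j) s < size s)%N.
    by move=> wj; rewrite index_mem as_.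
  have [j1 wj1] : exists j, 0 < w j.
    apply: contrapT => /forallNP wn; move: w1; rewrite big1.
      by move/eqP; rewrite eq_sym oner_eq0.
    by move=> j _; apply/le_anti; rewrite w0 andbT leNgt; apply/negP/wn.
  (* Position of [a j] among the distinct atoms; the default value is reached only by indices of
     zero weight. *)
  pose p j : 'I_(size s) :=
    if insub (index (a j) s) is Some i then i else Ordinal (idx j1 wj1).
  have bp j i : 0 < w j -> (p j == i) = (a j == b i).
    move=> wj; rewrite /p insubT; first exact: (idx j wj).
    move=> lts /=; apply/eqP/eqP => [<-|ab].
      by rewrite /b (tnth_nth (a j))/= nth_index ?as_.
    apply/val_inj => /=; rewrite ab /b (tnth_nth (a j))/=.
    by rewrite index_uniq ?undup_uniq.
  rewrite (partition_big p predT)//=; apply: eq_bigr => i _.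
  rewrite /v mulr_suml; apply: eq_big => [j|j /andP[wj /eqP pj]].
    by case: ltP => //= wj; rewrite bp.
  by congr (_ * g _); apply/eqP; rewrite -bp// pj.
exists (size s), b, v; split=> //.
- rewrite (leq_trans (size_undup _))// size_map.
  by rewrite (leq_trans (size_subseq (filter_subseq _ _)))// size_enum_ord.
- by apply/tuple_uniqP; exact: undup_uniq.
- move=> i; have : b i \in s by exact: mem_tnth.
  rewrite mem_undup => /mapP[j]; rewrite mem_filter => /andP[wj _] bij.
  rewrite /v (bigD1 j)/=; last by rewrite wj bij eqxx.
  by rewrite ltr_pwDl// sumr_ge0.
- have := sumE (fun=> 1); under eq_bigr do rewrite mulr1.
  by rewrite w1; under eq_bigr do rewrite mulr1.
Qed.

(** * Gaussian densities: positivity, boundedness, continuity and decay *)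

Section gauss.
Context (R : realType) (d : nat) (Sigma : 'M[R]_d).
Hypothesis hSigma : posdefmx Sigma.

Lemma posdefmx_unit : Sigma \in unitmx.
Proof.
case: hSigma => _ pos; rewrite -row_free_unit -kermx_eq0.
apply/rowV0P => v /sub_kermxP vS; apply/eqP/negPn/negP => v0.
have := pos v^T; rewrite trmx_eq0 => /(_ v0).
by rewrite trmxK vS mul0mx mxE ltxx.
Qed.

Let Q (x : 'cV[R]_d) : R := (x^T *m invmx Sigma *m x) 0 0.

(* Nonnegativity of [(a y - b e_k)^T Sigma (a y - b e_k)] with
   [y = Sigma^-1 x], [a = Sigma_kk] and [b = x_k]. *)
Lemma invmx_quad_ge (k : 'I_d) (x : 'cV[R]_d) :
  0 < Sigma k k /\ x k 0 ^+ 2 <= Sigma k k * Q x.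
Proof.
case: hSigma => Ssym pos.
pose e : 'cV[R]_d := delta_mx k 0.
pose y := invmx Sigma *m x.
have Sy : Sigma *m y = x by rewrite mulmxA mulmxV ?mul1mx// posdefmx_unit.
have pos0 (z : 'cV[R]_d) : 0 <= (z^T *m Sigma *m z) 0 0.
  have [->|z0] := eqVneq z 0; last exact/ltW/pos.
  by rewrite mulmx0 mxE.
have eM (z : 'cV[R]_d) : (e^T *m z) 0 0 = z k 0.
  by rewrite trmx_delta -rowE mxE.
have eSe : (e^T *m Sigma *m e) 0 0 = Sigma k k.
  by rewrite -mulmxA eM -colE mxE.
have Sk : 0 < Sigma k k.
  rewrite -eSe; apply: pos; apply/negP => /eqP/matrixP/(_ k 0)/eqP.
  by rewrite !mxE !eqxx oner_eq0.
split=> //.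
have eSy : (e^T *m Sigma *m y) 0 0 = x k 0 by rewrite -mulmxA Sy eM.
have ySe : (y^T *m Sigma *m e) 0 0 = x k 0.
  rewrite -eSy -[in RHS](trmxK (e^T *m Sigma *m y)) [RHS]mxE.
  by rewrite !trmx_mul trmxK Ssym mulmxA.
have ySy : (y^T *m Sigma *m y) 0 0 = Q x.
  by rewrite -mulmxA Sy /Q /y trmx_mul trmx_inv Ssym.
set a := Sigma k k; set b := x k 0.
have := pos0 (a *: y - b *: e).
have -> : (a *: y - b *: e)^T = a *: y^T - b *: e^T.
  by rewrite !linearD !linearN !linearZ.
rewrite !mulmxBl !mulmxBr -!scalemxAl -!scalemxAr.
have mxB (M N : 'M[R]_1) : (M - N) 0 0 = M 0 0 - N 0 0 by rewrite !mxE.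
have mxZ c (M : 'M[R]_1) : (c *: M) 0 0 = c * M 0 0 by rewrite mxE.
rewrite !(mxB, mxZ) ySy ySe eSy eSe -/a -/b => h.
(* The quadratic form expands to [a * (a * Q x - b^2)], and [a > 0] cancels. *)
rewrite -subr_ge0 -(pmulr_rge0 _ Sk) -/a; apply: le_trans h _.
by rewrite le_eqVlt; apply/predU1P; left; ring.
Qed.

Lemma invmx_quad_ge0 (x : 'cV[R]_d) : 0 <= Q x.
Proof.
have [->|/eqP x0] := eqVneq x 0; first by rewrite /Q mulmx0 mxE.
have [k xk] : exists k, x k 0 != 0.
  apply: contrapT => /forallNP xk; apply: x0; apply/colP => k; rewrite mxE.
  by apply/eqP/negPn/negP/xk.
have [Sk xkQ] := invmx_quad_ge k x.
by rewrite -(pmulr_rge0 _ Sk) (le_trans _ xkQ)// sqr_ge0.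
Qed.

Let C : R := \det ((2 * pi) *: Sigma) `^ (- 2^-1).

Let C_gt0 : 0 < C.
Proof.
(* A power of a nonzero base is an exponential by definition, so a nonvanishing determinant
   suffices. *)
rewrite /C /powR ifF ?expR_gt0//; apply/negbTE.
rewrite -unitfE -unitmxE unitmxZ ?posdefmx_unit//.
by rewrite unitfE mulf_neq0 ?gt_eqF// pi_gt0.
Qed.

Lemma gauss_density_gt0 x : 0 < gauss_density Sigma x.
Proof. by rewrite mulr_gt0 ?C_gt0 ?expR_gt0. Qed.

Lemma gauss_density_le x :
  gauss_density Sigma x <= \det ((2 * pi) *: Sigma) `^ (- 2^-1).
Proof.
rewrite ger_pMr ?C_gt0// expR_le1 mulNr oppr_le0 mulr_ge0//.
exact: invmx_quad_ge0.
Qed.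

Lemma gauss_density_continuous : continuous (gauss_density Sigma).
Proof.
have coord i : continuous (fun x : 'cV[R]_d => x i 0).
  exact: coord_continuous.
have Q_cont : continuous Q.
  have -> : Q = fun x => \sum_j (\sum_i x i 0 * invmx Sigma i j) * x j 0.
    apply/funext => x; rewrite /Q mxE; apply: eq_bigr => j _; rewrite mxE.
    by congr (_ * _); apply: eq_bigr => i _; rewrite mxE.
  apply: continuous_big; first exact: add_continuous.
  have row_cont j :
      continuous (fun x : 'cV[R]_d => \sum_i x i 0 * invmx Sigma i j).
    apply: continuous_big; first exact: add_continuous.
    by move=> i _ x; exact: (cvgM (coord i x) (cvg_cst _)).
  by move=> j _ x; exact: (cvgM (row_cont j x) (coord j x)).
have hQ : continuous (fun y => - 2^-1 * Q y).
  by move=> x; exact: (cvgM (cvg_cst _) (Q_cont x)).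
have hE : continuous (fun y => expR (- 2^-1 * Q y)).
  by move=> x; apply: (continuous_comp (hQ x)); exact: continuous_expR.
by move=> x; exact: (cvgM (cvg_cst _) (hE x)).
Qed.

(** A large coordinate makes [Q x] large by [invmx_quad_ge], and [expR (- Q x / 2) <= 2 / Q x]. *)
Lemma gauss_density_vanish (c : R) : 0 < c ->
  exists r : R, forall x : 'cV[R]_d,
    (exists k, r <= `|x k 0|) -> gauss_density Sigma x <= c.
Proof.
move=> c0.
(* Chosen so that [C * (2 / q) = c]. *)
pose q := 2 * C / c.
have q0 : 0 < q by rewrite divr_gt0// mulr_gt0.
(* The trace dominates every [Sigma k k], making the radius independent of [k]; the added 1 gives
   [(1 + s)^2 >= s] for [s = q * Sigma k k]. *)
exists (1 + q * \sum_k Sigma k k) => x [k xk].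
have [Sk xkQ] := invmx_quad_ge k x.
have Sle : Sigma k k <= \sum_k Sigma k k.
  rewrite (bigD1 k)//= lerDl sumr_ge0// => i _.
  by have [/ltW] := invmx_quad_ge i x.
have r1 : 1 + q * Sigma k k <= `|x k 0|.
  by apply: le_trans xk; rewrite lerD2l ler_pM2l.
have Qq : q <= Q x.
  rewrite -(ler_pM2l Sk); apply: le_trans xkQ; rewrite -real_normK ?num_real//.
  by nra.
have e1 : expR (- 2^-1 * Q x) <= (2^-1 * Q x)^-1.
  rewrite mulNr expRN lef_pV2 ?posrE ?expR_gt0//; last by rewrite mulr_gt0//; lra.
  by apply: le_trans (expR_ge1Dx _); lra.
rewrite /gauss_density -/C -/(Q x).
apply: (@le_trans _ _ (C * (2^-1 * Q x)^-1)); first by rewrite ler_pM2l.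
rewrite ler_pdivrMr; last by rewrite mulr_gt0//; lra.
move: Qq; rewrite ler_pdivrMr// => Qq; lra.
Qed.

End gauss.

Lemma cV_box_compact (R : realType) (d : nat) (r : R) :
  compact [set x : 'cV[R]_d | forall k, `|x k 0| <= r].
Proof.
pose box := [set x : 'rV[R]_d | forall k, `[- r, r]%classic (x ord0 k)].
have box_compact : compact box.
  apply: (@rV_compact R d (fun=> `[- r, r]%classic)) => _.
  exact: segment_compact.
have tr_cont : continuous (@trmx R 1 d).
  move=> x s /= /(nbhs_ballP x^T) [e e0 es].
  apply/nbhs_ballP; exists e => //= y [_ xy]; apply: es; split=> // i j.
  by rewrite !mxE; exact: xy.
have -> : [set x : 'cV[R]_d | forall k, `|x k 0| <= r] = @trmx R 1 d @` box.
  apply/seteqP; split=> [x xr|_ [y yr <-]].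
    exists x^T; last by rewrite trmxK.
    by move=> k; rewrite /= in_itv/= mxE -ler_norml.
  by move=> k; rewrite mxE; have := yr k; rewrite /= in_itv/= -ler_norml.
by apply: continuous_compact => //; exact: continuous_subspaceT.
Qed.

Lemma gauss_family_vanish (R : realType) (n d : nat) (X : 'I_n -> 'cV[R]_d)
    (Sigma : 'I_n -> 'M[R]_d) (c : R) :
  (forall i, posdefmx (Sigma i)) -> 0 < c ->
  exists2 K : set 'cV[R]_d, compact K &
    forall t, ~ K t -> forall i, gauss_density (Sigma i) (X i - t) <= c.
Proof.
move=> hSigma c0.
have [r rP] := choice (fun i => gauss_density_vanish (hSigma i) c0).
(* [M] dominates [r i + |X i k|] for all [i] and [k], so [|t k| > M] forces
   [|X i k - t k| >= r i]. *)
pose M := \sum_i (`|r i| + \sum_k `|X i k 0|).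
exists [set t : 'cV[R]_d | forall k, `|t k 0| <= M]; first exact: cV_box_compact.
move=> t /existsNP[k /negP]; rewrite -ltNge => tk i.
apply: rP; exists k; rewrite !mxE.
have Mi : `|r i| + `|X i k 0| <= M.
  apply: (@le_trans _ _ (`|r i| + \sum_k `|X i k 0|)).
    by rewrite lerD2l (bigD1 k)//= lerDl sumr_ge0.
  rewrite /M (bigD1 i)//= lerDl sumr_ge0// => j _.
  by rewrite addr_ge0// sumr_ge0.
have := lerB_dist (t k 0) (X i k 0); rewrite distrC.
by have := ler_norm (r i); lra.
Qed.

(** * Borel measurability, finite mixtures as probabilities, and integrals *)

Lemma open_borelV (R : realType) (d : nat) (U : set 'cV[R]_d) :
  open U -> measurable (U : set (borelV R d)).
Proof. by move=> oU; exact: sub_sigma_algebra. Qed.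

Lemma continuous_borelV_measurable (R : realType) (d : nat) (f : 'cV[R]_d -> R) :
  continuous f -> measurable_fun setT (f : borelV R d -> R).
Proof.
move=> /continuousP cf; apply: (measurability _ (RGenOpens.measurableE R)).
move=> _ [_ [a [b ->] <-]]; rewrite setTI.
by apply: open_borelV; apply: cf; exact: interval_open.
Qed.

Section finite_mixture_probability.
Context (R : realType) (d : nat) (k : nat) (a : 'I_k -> 'cV[R]_d) (w : 'I_k -> R).
Hypotheses (w_ge0 : forall j, 0 <= w j) (w_sum : \sum_j w j = 1).

(** [msum] sums a family indexed by [nat]; the zero measure fills indices from [k] on, which the sum
    never reaches. *)
Let component (j : nat) : {measure set (borelV R d) -> \bar R} :=
  if insub j is Some i
  then mscale (NngNum (w_ge0 i)) (\d_(a i : borelV R d))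
  else mzero.

Let finite_mixture : set (borelV R d) -> \bar R := msum component k.

HB.instance Definition _ := Measure.on finite_mixture.

Let finite_mixtureE (A : set (borelV R d)) :
  finite_mixture A = (\sum_(j < k) (w j)%:E * \d_(a j : borelV R d) A)%E.
Proof.
rewrite /finite_mixture /msum; apply: eq_bigr => j _.
by rewrite /component valK.
Qed.

Let finite_mixture_setT : finite_mixture setT = 1%E.
Proof.
rewrite finite_mixtureE; under eq_bigr do rewrite diracT mule1.
by rewrite sumEFin w_sum.
Qed.

HB.instance Definition _ :=
  @Measure_isProbability.Build _ _ R finite_mixture finite_mixture_setT.

Let Rintegral_finite_mixture (f : borelV R d -> R) :
  measurable_fun setT f -> (forall t, 0 <= f t) ->
  \int[finite_mixture]_t f t = \sum_(j < k) w j * f (a j).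
Proof.
move=> mf f0; have mf' := (measurable_EFinP _ _).2 mf.
rewrite /Rintegral ge0_integral_measure_sum//=; last first.
  by move=> t _; rewrite lee_fin.
rewrite -[RHS]/(fine (_ %:E)) -sumEFin; congr fine; apply: eq_bigr => j _.
rewrite /component valK ge0_integral_mscale//=; last first.
  by move=> t _; rewrite lee_fin.
by rewrite integral_dirac// diracT mul1e EFinM.
Qed.

Lemma exists_finite_mixture : exists G : probability (borelV R d) R,
  (forall A, G A = (\sum_(j < k) (w j)%:E * \d_(a j : borelV R d) A)%E) /\
  forall f : borelV R d -> R, measurable_fun setT f -> (forall t, 0 <= f t) ->
    \int[G]_t f t = \sum_(j < k) w j * f (a j).
Proof.
exists finite_mixture; split; first exact: finite_mixtureE.
exact: Rintegral_finite_mixture.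
Qed.

End finite_mixture_probability.

Section bounded_integrals.
Context (R : realType) (d : nat) (G : probability (borelV R d) R).

Lemma bounded_integrable (f : borelV R d -> R) (B : R) :
  measurable_fun setT f -> (forall t, `|f t| <= B) ->
  G.-integrable setT (EFin \o f).
Proof.
move=> mf fB; apply: measurable_bounded_integrable => //.
  by rewrite [X in (X < _)%E](@probability_setT _ _ _ G) ltry.
exists B; split; first exact: num_real.
by move=> C BC t _; apply: le_trans (fB t) (ltW BC).
Qed.

Lemma Rintegral_eq0_measure0 (f : borelV R d -> R) :
  G.-integrable setT (EFin \o f) -> (forall t, 0 <= f t) ->
  \int[G]_t f t = 0 -> G [set t | 0 < f t] = 0%E.
Proof.
move=> intf f0 If; have mf := measurable_int G intf.
have : (\int[G]_t `|(EFin \o f) t| = 0)%E.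
  have -> : (\int[G]_t `|(EFin \o f) t| = \int[G]_t (EFin \o f) t)%E.
    by apply: eq_integral => t _ /=; rewrite ger0_norm.
  (* Integrability excludes an infinite integral, which [fine] would also send to 0. *)
  rewrite -[LHS]fineK; last exact: integrable_fin_num.
  by congr EFin.
move=> /(ae_eq_integral_abs G measurableT mf)[N [mN N0 Nsub]].
apply: (subset_measure0 _ mN) => //.
  rewrite (_ : [set t | 0 < f t] = f @^-1` `]0, +oo[); last first.
    by apply/seteqP; split=> t /=; rewrite in_itv/= andbT.
  by rewrite -[X in measurable X]setTI; apply: ((measurable_EFinP _ _).1 mf).
by move=> t ft; apply: Nsub => /= /(_ Logic.I) [] /eqP; rewrite gt_eqF.
Qed.

Lemma Rintegral_gt0 (f : borelV R d -> R) :
  G.-integrable setT (EFin \o f) -> (forall t, 0 < f t) -> 0 < \int[G]_t f t.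
Proof.
move=> intf f0; have : 0 <= \int[G]_t f t.
  by apply: Rintegral_ge0 => t _; exact: ltW.
rewrite le_eqVlt => /predU1P[/esym If|//].
have := Rintegral_eq0_measure0 intf (fun t => ltW (f0 t)) If.
rewrite (_ : [set t | 0 < f t] = setT); last first.
  by apply/seteqP; split=> // t _; exact: f0.
by rewrite [X in X = _](@probability_setT _ _ _ G) => /eqP; rewrite eqe oner_eq0.
Qed.

End bounded_integrals.

(** The [?= iff] form carries the equality case through [leif_sum]. *)
Lemma ln_le_subr1 (R : realType) (x : R) : 0 < x -> ln x <= x - 1 ?= iff (x == 1).
Proof.
move=> x0; split.
  by have := expR_ge1Dx (ln x); rewrite lnK ?posrE//; lra.
have [->|x1] := eqVneq x 1; first by rewrite ln1 subrr eqxx.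
have lnx : ln x != 0 by rewrite ln_eq0.
have := expR_gt1Dx lnx; rewrite lnK ?posrE// => h.
by apply/negbTE; rewrite lt_eqF//; lra.
Qed.

Lemma Rintegral_lincomb (R : realType) (d : nat) (G : probability (borelV R d) R)
    (I : Type) (r : seq I) (c : I -> R) (f : I -> borelV R d -> R) :
  (forall i, G.-integrable setT (EFin \o f i)) ->
  G.-integrable setT (EFin \o (fun t => \sum_(i <- r) c i * f i t)) /\
  \int[G]_t (\sum_(i <- r) c i * f i t) = \sum_(i <- r) c i * \int[G]_t f i t.
Proof.
move=> intf; elim: r => [|i r [IH1 IH2]].
  rewrite big_nil; under [X in EFin \o X]eq_fun do rewrite big_nil.
  under eq_Rintegral do rewrite big_nil.
  split; last by rewrite Rintegral_cst// mul0r.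
  exact: finite_measure_integrable_cst.
have int_i : G.-integrable setT (EFin \o (fun t => c i * f i t)).
  exact: (integrableZl measurableT (c i) (intf i)).
rewrite big_cons; under [X in EFin \o X]eq_fun do rewrite big_cons.
under eq_Rintegral do rewrite big_cons.
split; first exact: (integrableD measurableT int_i IH1).
by rewrite RintegralD// RintegralZl// IH2.
Qed.

(** * Optimality conditions for the NPMLE *)

Section npmle.
Context (R : realType) (n d : nat) (X : 'I_n -> 'cV[R]_d)
  (Sigma : 'I_n -> 'M[R]_d).
Hypotheses (n_gt0 : (0 < n)%N) (hSigma : forall i, posdefmx (Sigma i)).
Implicit Type G : probability (borelV R d) R.

Local Notation phi := (fun i t => gauss_density (Sigma i) (X i - t)).
Local Notation lik G i := (mixture_density G (Sigma i) (X i)).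
Local Notation D := (dir_deriv X Sigma).

Let phi_gt0 i t : 0 < phi i t. Proof. exact: gauss_density_gt0. Qed.

Let phi_continuous i : continuous (phi i).
Proof.
have sub_cont : continuous (fun t : 'cV[R]_d => X i - t).
  by move=> t; exact: (cvgB (cvg_cst _) cvg_id).
move=> t; apply: (continuous_comp (sub_cont t)).
exact: gauss_density_continuous.
Qed.

Let phi_measurable i : measurable_fun setT (phi i : borelV R d -> R).
Proof. exact: continuous_borelV_measurable. Qed.

Let phi_integrable G i :
  G.-integrable setT (EFin \o (phi i : borelV R d -> R)).
Proof.
apply: (@bounded_integrable _ _ _ _ (\det ((2 * pi) *: Sigma i) `^ (- 2^-1))) => // t.
by rewrite ger0_norm ?(ltW (phi_gt0 _ _))// gauss_density_le.
Qed.

Lemma mixture_density_gt0 G i : 0 < lik G i.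
Proof. by apply: Rintegral_gt0 => [|t]; [exact: phi_integrable|exact: phi_gt0]. Qed.

Let dir_derivE G t : D G t = \sum_i (n%:R^-1 / lik G i) * phi i t - 1.
Proof.
rewrite /dir_deriv mulr_sumr; congr (_ - _); apply: eq_bigr => i _.
by rewrite -mulrA; congr (_ * _); rewrite mulrC.
Qed.

(** By definition the integral of [phi i] against [G'] is the likelihood of [G'], so linearity
    suffices. *)
Lemma Rintegral_dir_deriv G G' :
  G'.-integrable setT (EFin \o (D G : borelV R d -> R)) /\
  \int[G']_t (D G : borelV R d -> R) t
    = n%:R^-1 * (\sum_i lik G' i / lik G i) - 1.
Proof.
have [int_sum sumE] := Rintegral_lincomb (index_enum 'I_n)
  (fun i => n%:R^-1 / lik G i) (phi_integrable G').
have int1 : G'.-integrable setT (EFin \o (cst 1 : borelV R d -> R)).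
  exact: finite_measure_integrable_cst.
have -> : D G = fun t => \sum_i (n%:R^-1 / lik G i) * phi i t - 1.
  by apply/funext => t; exact: dir_derivE.
split; first exact: (integrableB measurableT int_sum int1).
rewrite RintegralB// sumE Rintegral_cst//.
rewrite [X in fine X](@probability_setT _ _ _ G')/= mulr1; congr (_ - _).
rewrite mulr_sumr; apply: eq_bigr => i _.
by rewrite -mulrA; congr (_ * _); rewrite mulrC.
Qed.

Lemma dir_deriv_continuous G : continuous (D G).
Proof.
have -> : D G = (fun t => \sum_i (n%:R^-1 / lik G i) * phi i t - 1).
  by apply/funext => t; exact: dir_derivE.
have sum_cont : continuous (fun t => \sum_i (n%:R^-1 / lik G i) * phi i t).
  apply: continuous_big; first exact: add_continuous.
  by move=> i _ t; exact: (cvgM (cvg_cst _) (@phi_continuous i t)).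
by move=> t; exact: (cvgB (sum_cont t) (cvg_cst _)).
Qed.

Lemma loglik_le_of_dir_deriv G : (forall t, D G t <= 0) -> forall G',
  loglik X Sigma G' <= loglik X Sigma G /\
  (loglik X Sigma G <= loglik X Sigma G' -> forall i, lik G' i = lik G i).
Proof.
move=> DG G'; pose r i := lik G' i / lik G i.
have nR0 : 0 < n%:R :> R by rewrite ltr0n.
have r0 i : 0 < r i by rewrite divr_gt0// mixture_density_gt0.
have r_sum : \sum_i (r i - 1) <= 0.
  have [int_D intE] := Rintegral_dir_deriv G G'.
  have : \int[G']_t (D G : borelV R d -> R) t <= 0.
    rewrite -[leRHS](mul0r (fine (G' setT))) -Rintegral_cst//.
    by apply: le_Rintegral => //; exact: finite_measure_integrable_cst.
  rewrite intE subr_le0 -(ler_pM2l nR0) mulrA divff ?gt_eqF// mul1r mulr1.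
  by rewrite big_split/= sumrN sumr_const card_ord subr_le0.
have lnE : \sum_i ln (lik G' i) - \sum_i ln (lik G i) = \sum_i ln (r i).
  rewrite -sumrB; apply: eq_bigr => i _.
  by rewrite ln_div// posrE mixture_density_gt0.
have [ln_le ln_eq] : \sum_i ln (r i) <= \sum_i (r i - 1)
    ?= iff [forall (i | xpredT i), r i == 1].
  by apply: leif_sum => i _; exact: ln_le_subr1.
split.
  rewrite /loglik ler_pM2l ?invr_gt0// -subr_le0 lnE.
  exact: le_trans r_sum.
rewrite /loglik ler_pM2l ?invr_gt0// -subr_ge0 lnE => ln_ge.
(* Squeeze: [0 <= \sum_i ln (r i) <= \sum_i (r i - 1) <= 0], so every termwise inequality is an
   equality. *)
have : \sum_i ln (r i) == \sum_i (r i - 1).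
  by rewrite eq_le ln_le (le_trans r_sum).
rewrite ln_eq => /forallP ri i; have := ri i.
rewrite /r /= => /eqP h; rewrite -[RHS]mul1r -h divfK// gt_eqF//.
exact: mixture_density_gt0.
Qed.

Lemma exists_discrete_dir_deriv_le0 :
  exists2 G, discrete_atmost n G & forall t, D G t <= 0.
Proof.
pose B := \sum_i \det ((2 * pi) *: Sigma i) `^ (- 2^-1).
have phiB i t : phi i t <= B.
  apply: (le_trans (gauss_density_le (hSigma i) _)).
  by rewrite /B (bigD1 i)//= lerDl sumr_ge0// => j _; exact: powR_ge0.
have [w [a [w1 opt]]] := lik_optimum n_gt0 phi_gt0 phi_continuous 0 phiB
  (fun c c0 => gauss_family_vanish X hSigma c0).
have [k [b [v [kn b_inj v0 v1 vE]]]] := simplex_merge_atoms a w1.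
have v_ge0 j : 0 <= v j by exact: ltW.
have [G [GE G_int]] := exists_finite_mixture b v_ge0 v1.
have likE i : lik G i = mixture_lik phi w a i.
  rewrite /mixture_density G_int//; last by move=> t; exact: ltW.
  by have := vE (phi i) => <-.
exists G.
  by exists k, b, v; split=> // A _; exact: GE.
move=> t; rewrite /dir_deriv subr_le0 mulrC ler_pdivrMr ?ltr0n// mul1r.
by under eq_bigr do rewrite likE.
Qed.

(** Necessity needs no differentiation at [G]: a maximiser shares its likelihoods with the discrete
    [G0], and [D] depends on the measure only through them. *)
Lemma npmle_dir_deriv G : is_npmle X Sigma G <-> forall t, D G t <= 0.
Proof.
split=> [Gmax t|DG G']; last exact: (loglik_le_of_dir_deriv DG G').1.
have [G0 _ DG0] := exists_discrete_dir_deriv_le0.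
have likE := (loglik_le_of_dir_deriv DG0 G).2 (Gmax G0).
by rewrite /dir_deriv; under eq_bigr do rewrite likE; exact: DG0.
Qed.

Lemma npmle_dir_deriv_lt0 G : is_npmle X Sigma G -> G [set t | D G t < 0] = 0%E.
Proof.
move=> /npmle_dir_deriv DG; have [int_D intE] := Rintegral_dir_deriv G G.
have nR0 : n%:R != 0 :> R by rewrite pnatr_eq0 -lt0n.
have int0 : \int[G]_t (D G : borelV R d -> R) t = 0.
  rewrite intE (eq_bigr (fun=> 1)) => [|i _]; last first.
    by rewrite divff// gt_eqF// mixture_density_gt0.
  by rewrite sumr_const card_ord mulVf// subrr.
have int_ND : G.-integrable setT (EFin \o (fun t : borelV R d => - 1 * D G t)).
  exact: (integrableZl measurableT (-1) int_D).
have -> : [set t | D G t < 0] = [set t | 0 < - 1 * D G t].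
  by apply/seteqP; split=> t /=; rewrite mulN1r oppr_gt0.
apply: Rintegral_eq0_measure0 => //.
  by move=> t; rewrite mulN1r oppr_ge0.
by rewrite RintegralZl// int0 mulr0.
Qed.

End npmle.

Theorem lemma1 (R : realType) (n d : nat) (hn : (0 < n)%N) (hd : (0 < d)%N)
    (X : 'I_n -> 'cV[R]_d) (Sigma : 'I_n -> 'M[R]_d)
    (hSigma : forall i, posdefmx (Sigma i)) :
  [/\ (exists G : probability (borelV R d) R,
         is_npmle X Sigma G /\ discrete_atmost n G)
      /\ (forall G1 G2 : probability (borelV R d) R,
            is_npmle X Sigma G1 -> is_npmle X Sigma G2 ->
            fitted_lik X Sigma G1 = fitted_lik X Sigma G2),
      forall G : probability (borelV R d) R,
        is_npmle X Sigma G <-> forall t : 'cV[R]_d, dir_deriv X Sigma G t <= 0 &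
      forall G : probability (borelV R d) R, is_npmle X Sigma G ->
        msupport G `<=` zero_set X Sigma G
        /\ zero_set X Sigma G
           = global_maximizers (dual_mixture X Sigma (fitted_lik X Sigma G))].
Proof.
have nR0 : 0 < n%:R :> R by rewrite ltr0n.
have [G0 G0_discrete DG0] := exists_discrete_dir_deriv_le0 X hn hSigma.
split; first split.
- by exists G0; split=> //; apply/npmle_dir_deriv.
- move=> G1 G2 G1max G2max; apply/rowP => i; rewrite !mxE.
  have DG2 := (npmle_dir_deriv X hn hSigma G2).1 G2max.
  exact: (loglik_le_of_dir_deriv hn hSigma DG2 G1).2 (G1max G2) i.
- by move=> G; exact: npmle_dir_deriv.
move=> G Gmax; have DG := (npmle_dir_deriv X hn hSigma G).1 Gmax.
have DG_lt0 := npmle_dir_deriv_lt0 hn hSigma Gmax.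
have D_open : open [set t | dir_deriv X Sigma G t < 0].
  have D_cont : continuous (dir_deriv X Sigma G).
    exact: dir_deriv_continuous.
  exact: ((continuousP _).1 D_cont _ (@open_lt R 0)).
split=> [t tG|].
  apply/eqP; rewrite eq_le DG leNgt; apply/negP => Dt.
  by have := tG _ D_open Dt; rewrite DG_lt0 ltxx.
(* Otherwise [D < 0] everywhere, and the null set of [npmle_dir_deriv_lt0] would be the whole space.
   Hence the maximum of [D] is exactly 0. *)
have [t0 Dt0] : exists t0, dir_deriv X Sigma G t0 = 0.
  apply: contrapT => /forallNP Dn0.
  have D_lt0 : [set t | dir_deriv X Sigma G t < 0] = setT.
    apply/seteqP; split=> // t _ /=; rewrite lt_neqAle DG andbT.
    by apply/eqP/Dn0.
  have := @probability_setT _ _ _ G; rewrite -D_lt0 DG_lt0 => /esym/eqP.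
  by rewrite eqe oner_eq0.
pose S := \sum_k (fitted_lik X Sigma G 0 k)^-1.
have S0 : 0 < S.
  rewrite /S (bigD1 (Ordinal hn))//= ltr_pwDl//.
    by rewrite mxE invr_gt0 mixture_density_gt0.
  by apply: sumr_ge0 => k _; rewrite mxE invr_ge0 ltW// mixture_density_gt0.
(* The dual mixture is an increasing affine function of [D], so both have the same global
   maximizers. *)
have dualE t : dual_mixture X Sigma (fitted_lik X Sigma G) t =
    (dir_deriv X Sigma G t + 1) * (n%:R / S).
  rewrite /dir_deriv subrK mulrACA mulVf ?mul1r ?gt_eqF// mulr_suml.
  by apply: eq_bigr => i _; rewrite -/S mxE mulrC mulrA.
have dual_le u t : (dual_mixture X Sigma (fitted_lik X Sigma G) u
    <= dual_mixture X Sigma (fitted_lik X Sigma G) t)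
    = (dir_deriv X Sigma G u <= dir_deriv X Sigma G t).
  by rewrite !dualE ler_pM2r ?divr_gt0// lerD2r.
apply/seteqP; split=> [t Dt u|t tmax]; first by rewrite dual_le Dt DG.
by apply/eqP; rewrite eq_le DG -Dt0 -dual_le tmax.
Qed.
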